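(* Let $S_1,S_2:[0,1]^2\to[0,1]$ be continuous cancellative t-subnorms with additive generators $s_1:[0,1]\to[s_1(1),\infty]$ and $s_2:[0,1]\to[s_2(1),\infty]$, respectively (normalized, i.e. $s_i(1)=1$, whenever $S_i$ is proper). If the function $\frac{s_1}{s_2}$ is non-decreasing on $(0,1)$, then $S_1\le S_2$ (pointwise on $[0,1]^2$).
   Context: A t-subnorm is a binary operation $S:[0,1]^2\to[0,1]$ that is commutative, associative, non-decreasing in both variables and satisfies $S(x,y)\le\min(x,y)$. It is cancellative if $S(x,y)=S(x,z)$ with $x>0$ implies $y=z$. A t-norm is a t-subnorm having $1$ as neutral element; a t-subnorm that is not a t-norm is called proper. By a known representation theorem, a t-subnorm $S$ is continuous and cancellative if and only if there is a continuous, strictly decreasing function $s:[0,1]\to[0,\infty]$ with $s(0)=\infty$ such that $S(x,y)=s^{-1}(s(x)+s(y))$ for all $x,y\in[0,1]$, where $s$ is viewed as a bijection $[0,1]\to[s(1),\infty]$ with inverse $s^{-1}$. Such an $s$ is called an additive generator of $S$; it is unique up to a positive multiplicative constant; $S$ is a (strict) t-norm iff $s(1)=0$ and proper iff $s(1)>0$. When $S$ is proper, its normalized additive generator is the one with $s(1)=1$. *)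

(* Defs.v *)
From HB Require Import structures.
From mathcomp Require Import all_boot all_order all_algebra.
From mathcomp Require Import all_classical all_reals all_analysis.

Set Implicit Arguments.
Unset Strict Implicit.
Unset Printing Implicit Defensive.

Import Order.TTheory GRing.Theory Num.Theory.
Import numFieldNormedType.Exports.

Local Open Scope classical_set_scope.
Local Open Scope ring_scope.

(* Binary operations on [0, 1] are functions R -> R -> R whose values outside
   [0, 1]^2 are irrelevant; likewise, additive generators are functions
   R -> \bar R whose values outside [0, 1] are irrelevant. *)
Section TSubnorm.
Context {R : realType}.
Implicit Types (S : R -> R -> R) (s : R -> \bar R).

Record is_tsubnorm S : Prop := IsTSubnorm {
  tsubnorm_closed : {in `[0, 1] &, forall x y, S x y \in `[0, 1]};
  tsubnormC : {in `[0, 1] &, commutative S};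
  tsubnormA : {in `[0, 1] & &, associative S};
  tsubnorm_homol :
    {in `[0, 1], forall z, {in `[0, 1] &, {homo S^~ z : x y / x <= y}}};
  tsubnorm_homor :
    {in `[0, 1], forall z, {in `[0, 1] &, {homo S z : x y / x <= y}}};
  tsubnorm_le_min : {in `[0, 1] &, forall x y, S x y <= Num.min x y} }.

Definition is_cancellative S : Prop :=
  forall x y z : R, x \in `[0, 1] -> y \in `[0, 1] -> z \in `[0, 1] ->
    S x y = S x z -> 0 < x -> y = z.

Definition is_continuous_on_square S : Prop :=
  {within `[0, 1] `*` `[0, 1], continuous (fun p : R * R => S p.1 p.2)}.

Definition is_tnorm S : Prop :=
  is_tsubnorm S /\ {in `[0, 1], forall x, S x 1 = x /\ S 1 x = x}.

Definition is_proper_tsubnorm S : Prop := is_tsubnorm S /\ ~ is_tnorm S.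

(* Under the first four conditions s is a bijection from [0, 1] onto
   [s 1, +oo], and 'pinv_(fun=> 0) `[0, 1] s is its inverse there. *)
Record is_additive_generator S s : Prop := IsAdditiveGenerator {
  addgen_continuous : {within `[0, 1], continuous s};
  addgen_decreasing : {in `[0, 1] &, forall x y : R, x < y -> (s y < s x)%E};
  addgen_ge0 : {in `[0, 1], forall x, (0 <= s x)%E};
  addgen_at0 : s 0 = +oo%E;
  addgenE : {in `[0, 1] &, forall x y,
    S x y = 'pinv_(fun=> 0) `[0, 1] s (s x + s y)%E} }.

End TSubnorm.

(* Main.v *)
Require Import Defs.
From mathcomp Require Import all_boot all_order all_algebra.
From mathcomp Require Import all_classical all_reals all_analysis.
Import Order.TTheory GRing.Theory Num.Theory.
Import numFieldNormedType.Exports.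
Local Open Scope classical_set_scope.
Local Open Scope ring_scope.

(* Set z = S1 x y with x, y in (0, 1), so that s1 z = s1 x + s1 y. Since z lies
   below x and y, the monotonicity of s1 / s2 gives s1 x >= (s1 z / s2 z) s2 x
   and likewise for y; adding up, s2 z >= s2 x + s2 y, that is z <= S2 x y. The
   sides of the square are reached by letting t tend to 1 in
   S1 (t x) (t y) <= S2 (t x) (t y) <= S2 x y. *)

Lemma pinv_notin {T U : Type} (dflt : U -> T) (A : set T) (f : T -> U) b :
  ~ (f @` A) b -> 'pinv_dflt A f b = dflt b.
Proof. by move=> Afb; rewrite /pinv_ splitV oinv_surj; case: pselect. Qed.

Section tsubnorm.
Context {R : realType}.
Implicit Types (S : R -> R -> R) (s : R -> \bar R) (x y t : R).

Let unit0 : (0 : R) \in `[0, 1]. Proof. by rewrite in_itv/= lexx ler01. Qed.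

Let unit1 : (1 : R) \in `[0, 1]. Proof. by rewrite in_itv/= lexx ler01. Qed.

Let unit_open {x} : x \in `]0, 1[ -> x \in `[0, 1].
Proof. exact: subset_itv_oo_cc. Qed.

Lemma tsubnorm0r {S x} : is_tsubnorm S -> x \in `[0, 1] -> S x 0 = 0.
Proof.
move=> St x01; apply/eqP; rewrite eq_le.
rewrite (le_trans (tsubnorm_le_min St x01 unit0)) ?ge_min ?lexx ?orbT//=.
by have /andP[] := tsubnorm_closed St x01 unit0.
Qed.

Lemma tsubnorm0l {S x} : is_tsubnorm S -> x \in `[0, 1] -> S 0 x = 0.
Proof. by move=> St x01; rewrite (tsubnormC St)// tsubnorm0r. Qed.

Lemma tsubnorm_le {S} : is_tsubnorm S ->
  {in `[0, 1] &, forall x y, S x y <= x /\ S x y <= y}.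
Proof.
move=> St x y x01 y01; apply/andP; rewrite -le_min.
exact: tsubnorm_le_min.
Qed.

Lemma tsubnorm_homo {S x y x' y'} : is_tsubnorm S ->
  x \in `[0, 1] -> y \in `[0, 1] -> x' \in `[0, 1] -> y' \in `[0, 1] ->
  x <= x' -> y <= y' -> S x y <= S x' y'.
Proof.
move=> St x01 y01 x'01 y'01 xx' yy'.
apply: (@le_trans _ _ (S x' y)); first exact: (tsubnorm_homol St).
exact: (tsubnorm_homor St).
Qed.

(** If [S x y] were [0], it would equal [S x 0], and cancelling [x > 0] would give [y = 0]. *)
Lemma tsubnorm_gt0 {S} : is_tsubnorm S -> is_cancellative S ->
  {in `]0, 1[ &, forall x y, 0 < S x y}.
Proof.
move=> St Sc x y x01 y01.
have [x0 _] := andP x01; have [y0 _] := andP y01.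
rewrite lt_neqAle; apply/andP; split; last first.
  by have /andP[] := tsubnorm_closed St (unit_open x01) (unit_open y01).
apply/eqP => S0; suff y0E : y = 0 by move: y0; rewrite y0E bnd_simp ltxx.
apply: (Sc x) => //; [exact: unit_open|exact: unit_open|].
by rewrite tsubnorm0r// unit_open.
Qed.

(* No intermediate value theorem is needed to see that s x + s y is a value of
   s: otherwise 'pinv would return its default 0, whereas S x y > 0. *)
Lemma addgen_tsubnorm {S s} : is_tsubnorm S -> is_cancellative S ->
  is_additive_generator S s ->
  {in `]0, 1[ &, forall x y, s (S x y) = (s x + s y)%E}.
Proof.
move=> St Sc gs x y x01 y01.
have := tsubnorm_gt0 St Sc _ _ x01 y01.
rewrite (addgenE gs) ?unit_open//.
have [im|im] := pselect ((s @` `[0, 1]) (s x + s y)%E).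
  by rewrite pinvK// inE.
by rewrite pinv_notin// ltxx.
Qed.

(** Strict decrease puts [s x] strictly between [s 1 >= 0] and [s 0 = +oo]. Thus on the open
    interval the extended quotient [s1 x / s2 x] is an ordinary quotient of positive reals. *)
Lemma addgen_fin {S s x} : is_additive_generator S s -> x \in `]0, 1[ ->
  exists2 r : R, s x = r%:E & 0 < r.
Proof.
move=> gs x01; have [x0 x1] := andP x01; move: x0 x1; rewrite !bnd_simp => x0 x1.
have := addgen_decreasing gs unit0 (unit_open x01) x0.
rewrite (addgen_at0 gs).
have : (0 < s x)%E.
  apply: le_lt_trans (addgen_decreasing gs (unit_open x01) unit1 x1).
  exact: (addgen_ge0 gs).
by case: (s x) => // r r_gt0 _; exists r.
Qed.

Lemma le_tsubnorm_open {S1 S2 s1 s2} :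
  is_tsubnorm S1 -> is_tsubnorm S2 ->
  is_cancellative S1 -> is_cancellative S2 ->
  is_additive_generator S1 s1 -> is_additive_generator S2 s2 ->
  {in `]0, 1[ &, {homo (fun x : R => (s1 x / s2 x)%E) :
    x y / x <= y >-> (x <= y)%E}} ->
  {in `]0, 1[ &, forall x y, S1 x y <= S2 x y}.
Proof.
move=> S1t S2t S1c S2c g1 g2 mono x y x01 y01.
have [xu yu] := (unit_open x01, unit_open y01).
set z := S1 x y; have [zx zy] := tsubnorm_le S1t _ _ xu yu.
have z01 : z \in `]0, 1[.
  rewrite in_itv/= tsubnorm_gt0//= (le_lt_trans zx)//.
  by case/andP: x01.
(* The generator is known to reverse strict inequalities, so the negated goal [S2 x y < z] is what
   can be fed to [s2]: it gives [s2 z < s2 x + s2 y]. *)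
rewrite leNgt; apply/negP => S2z.
have := addgen_decreasing g2 (tsubnorm_closed S2t xu yu) (unit_open z01) S2z.
rewrite (addgen_tsubnorm S2t S2c g2)//.
have := addgen_tsubnorm S1t S1c g1 _ _ x01 y01; rewrite -/z.
have := mono _ _ z01 y01 zy; have := mono _ _ z01 x01 zx.
(* The letters [a], [b], [c] stand for the values at [x], [y], [z], and the index for the generator.
   Clearing denominators, monotonicity becomes [c1 * a2 <= a1 * c2] and [c1 * b2 <= b1 * c2]. *)
have [a1 -> a1_gt0] := addgen_fin g1 x01; have [a2 -> a2_gt0] := addgen_fin g2 x01.
have [b1 -> b1_gt0] := addgen_fin g1 y01; have [b2 -> b2_gt0] := addgen_fin g2 y01.
have [c1 -> c1_gt0] := addgen_fin g1 z01; have [c2 -> c2_gt0] := addgen_fin g2 z01.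
rewrite !inver !gt_eqF// -!EFinM -!EFinD !lee_fin lte_fin.
rewrite ler_pdivrMr// mulrAC ler_pdivlMr// => ca.
rewrite ler_pdivrMr// mulrAC ler_pdivlMr// => cb [c1E].
(* The claim [a2 + b2 <= c2] is multiplied by [c1], and [c1 = a1 + b1] is substituted on the right
   only; what results is the sum of [ca] and [cb]. *)
apply/negP; rewrite -leNgt -(ler_pM2l c1_gt0) mulrDr [in leRHS]c1E mulrDl.
exact: lerD.
Qed.

Let unit_scale {t x} : t \in `]0, 1[ -> x \in `[0, 1] -> t * x \in `[0, 1].
Proof.
rewrite !in_itv/= => /andP[t0 t1] /andP[x0 x1].
by rewrite mulr_ge0 ?(ltW t0)//= mulr_ile1// ltW.
Qed.

Let near_unit_open : \forall t \near (1 : R)^'-, t \in `]0, 1[.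
Proof.
by near=> t; rewrite in_itv/=; apply/andP; split.
Unshelve. all: by end_near. Qed.

(** Continuity is available only within the square, but the segment from the origin to [(x, y)]
    stays inside it, so the limit along that segment is covered even at boundary points. *)
Lemma cvg_tsubnorm_diag {S x y} : is_continuous_on_square S ->
  x \in `[0, 1] -> y \in `[0, 1] ->
  S (t * x) (t * y) @[t --> 1^'-] --> S x y.
Proof.
move=> /subspace_continuousP Scont x01 y01.
have cvgM (z : R) : t * z @[t --> 1^'-] --> z.
  rewrite -[X in _ --> X]mul1r; apply: cvgMr_tmp.
  by apply: cvg_at_left_filter; exact: cvg_id.
have xy01 : (`[0, 1] `*` `[0, 1]) (x, y) by split.
apply: cvg_trans (Scont _ xy01).
move=> A /= wA.
apply: filterS2 near_unit_open (cvg_pair (cvgM x) (cvgM y) wA) => t t01.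
by apply; split; exact: unit_scale.
Qed.

Lemma le_tsubnorm S1 S2 : is_tsubnorm S1 -> is_tsubnorm S2 ->
  is_continuous_on_square S1 ->
  {in `]0, 1[ &, forall x y, S1 x y <= S2 x y} ->
  {in `[0, 1] &, forall x y, S1 x y <= S2 x y}.
Proof.
move=> S1t S2t S1cont S12 x y x01 y01.
(* Scaling by [t < 1] pulls a coordinate equal to [1] into the open interval but leaves a zero
   coordinate fixed; on those two sides both operations vanish. *)
have [->|x_neq0] := eqVneq x 0; first by rewrite !tsubnorm0l.
have [->|y_neq0] := eqVneq y 0; first by rewrite !tsubnorm0r.
have scale t z : t \in `]0, 1[ -> z \in `[0, 1] -> z != 0 ->
    t * z <= z /\ t * z \in `]0, 1[.
  rewrite !in_itv/= => /andP[t0 t1] /andP[z0 z1] z_neq0.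
  have z_gt0 : 0 < z by rewrite lt_neqAle eq_sym z_neq0.
  have tz : t * z < z by rewrite gtr_pMl.
  by rewrite mulr_gt0//= (ltW tz) (lt_le_trans tz).
(* The bound [S2 x y] does not depend on [t], so only the left side passes to the limit. *)
apply: (cvgr_to_le (cvg_tsubnorm_diag S1cont x01 y01)).
apply: filterS near_unit_open => t t01.
have [txx tx01] := scale _ _ t01 x01 x_neq0.
have [tyy ty01] := scale _ _ t01 y01 y_neq0.
apply: le_trans (S12 _ _ tx01 ty01) _.
by apply: tsubnorm_homo => //; exact: unit_open.
Qed.

End tsubnorm.

Theorem proposition3p5 (R : realType) (S1 S2 : R -> R -> R)
    (s1 s2 : R -> \bar R)
    (S1_tsubnorm : is_tsubnorm S1) (S2_tsubnorm : is_tsubnorm S2)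
    (S1_continuous : is_continuous_on_square S1)
    (S2_continuous : is_continuous_on_square S2)
    (S1_cancellative : is_cancellative S1)
    (S2_cancellative : is_cancellative S2)
    (s1_generator : is_additive_generator S1 s1)
    (s2_generator : is_additive_generator S2 s2)
    (s1_normalized : is_proper_tsubnorm S1 -> s1 1 = 1%E)
    (s2_normalized : is_proper_tsubnorm S2 -> s2 1 = 1%E)
    (s1_div_s2_nondecreasing :
      {in `]0, 1[ &, {homo (fun x : R => (s1 x / s2 x)%E) : x y / x <= y >-> (x <= y)%E}}) :
  {in `[0, 1] &, forall x y : R, S1 x y <= S2 x y}.
Proof.
apply: le_tsubnorm => //.
exact: (le_tsubnorm_open S1_tsubnorm S2_tsubnorm S1_cancellative
  S2_cancellative s1_generator s2_generator).
Qed.
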